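(* Let $K$ be a metric space and let $f:K\to\mathbb{C}$ be a strong $D$-function, i.e. $f\in SD(K)$. Then: (a) $f$ is a (complex) difference of semi-continuous strong $D$-functions; that is, there exist bounded real-valued lower semi-continuous functions $\varphi_1,\varphi_2,\varphi_3,\varphi_4$ belonging to $SD(K)$ with $f=(\varphi_1-\varphi_2)+i(\varphi_3-\varphi_4)$. (b) $|f|$ is a strong $D$-function.
   Context: $D(K)$ is the set of all $f:K\to\mathbb{C}$ of the form $f=(\varphi_1-\varphi_2)+i(\varphi_3-\varphi_4)$ with $\varphi_1,\dots,\varphi_4$ bounded real-valued lower semi-continuous functions on $K$. Equivalently, $f\in D(K)$ iff there is a sequence $(\varphi_j)$ of continuous complex-valued functions on $K$ with $\sup_{k\in K}\sum_j|\varphi_j(k)|<\infty$ and $f=\sum_j\varphi_j$ pointwise; $\|f\|_D$ is the infimum of $\sup_{k\in K}\sum_j|\varphi_j(k)|$ over all such sequences. $D(K)$ is a Banach algebra under $\|\cdot\|_D$. A function is simple if its range is finite. $SD(K)$ is the closure, in $(D(K),\|\cdot\|_D)$, of the set of simple functions belonging to $D(K)$; its members are called strong $D$-functions. *)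

(* Defs.v *)
From HB Require Import structures.
From mathcomp Require Import all_boot all_order all_algebra.
From mathcomp Require Import all_classical all_reals all_analysis.
From mathcomp Require Import complex.
Import Order.TTheory GRing.Theory Num.Theory.
Import numFieldNormedType.Exports.
Import ComplexField.Normc.

Set Implicit Arguments.
Unset Strict Implicit.
Unset Printing Implicit Defensive.

Local Open Scope classical_set_scope.
Local Open Scope ring_scope.
Local Open Scope complex_scope.

Section StrongD.
Context {R : realType} {K : metricType R}.
Implicit Types f g : K -> R[i].

Definition bounded_lsc (phi : K -> R) : Prop :=
  bounded_fun phi /\ lower_semicontinuous (EFin \o phi).

Definition complex_diff (phi1 phi2 phi3 phi4 : K -> R) : K -> R[i] :=
  fun k => (phi1 k - phi2 k) +i* (phi3 k - phi4 k).

Definition DK : set (K -> R[i]) := [set f |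
  exists phi1 phi2 phi3 phi4 : K -> R,
    [/\ bounded_lsc phi1, bounded_lsc phi2, bounded_lsc phi3, bounded_lsc phi4
      & f = complex_diff phi1 phi2 phi3 phi4]].

(* The maximum with 0 only matters for empty [K], where [ereal_sup] is -oo. *)
Definition sup_abs_sum (phi : nat -> K -> R[i]) : \bar R :=
  maxe 0%E (ereal_sup (range (fun k : K => \sum_(j <oo) (normc (phi j k))%:E)%E)).

(* [R[i]^o] is [R[i]] with the topology given by its modulus. *)
Definition D_series (phi : nat -> K -> R[i]) f : Prop :=
  [/\ forall j, continuous (phi j : K -> R[i]^o),
      (sup_abs_sum phi < +oo)%E
    & forall k, series (fun j => phi j k : R[i]^o) @ \oo --> (f k : R[i]^o)].

(* Extended-real valued: the value is +oo when [f] has no representation. *)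
Definition Dnorm f : \bar R :=
  ereal_inf [set sup_abs_sum phi | phi in [set phi | D_series phi f]].

Definition simple_fun f : Prop := finite_set (range f).

Definition SDK : set (K -> R[i]) := [set f | DK f /\
  forall e : R, 0 < e ->
    exists g, [/\ simple_fun g, DK g & (Dnorm (f \- g)%R < e%:E)%E]].

End StrongD.

(* Main.v *)
Require Import Defs.
From HB Require Import structures.
From mathcomp Require Import all_boot all_order all_algebra.
From mathcomp Require Import all_classical all_reals all_analysis.
From mathcomp Require Import complex.
From mathcomp Require Import ring lra.
Import Order.TTheory GRing.Theory Num.Theory.
Import numFieldNormedType.Exports.

Set Implicit Arguments.
Unset Strict Implicit.
Unset Printing Implicit Defensive.

Local Open Scope classical_set_scope.
Local Open Scope ring_scope.
Local Open Scope complex_scope.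

(* Say that [rho] controls [f] if [limsup (|f y - f x| - rho y) <= - rho x] as
   [y] tends to [x]. Up to a constant, [||f||_D] is the least [e] for which some
   [rho] with [|f| <= rho <= e] controls [f]: the sum of the [|phi_j|] controls
   the sum of the [phi_j], and conversely [rho], [rho + Re f] and [rho + Im f] are
   lower semi-continuous, hence sums of nonnegative continuous functions by
   Baire's theorem. The control of a simple function can be rounded to a simple
   one.

   (a) Write [f] as a [D]-convergent series of simple functions; the sum [rho] of
   simple controls of its terms is a lower semi-continuous strong [D]-function
   that controls [f], and [f = (rho + Re f - rho) + i (rho + Im f - rho)].

   (b) The map [f |-> |f|] preserves controls but is not Lipschitz for the
   [D]-norm; it is nevertheless continuous at strong [D]-functions, because a
   simple function has boundedly many jumps. *)

Local Notation normc := ComplexField.Normc.normc.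
Local Notation Re := complex.Re.
Local Notation Im := complex.Im.

(** * Elementary bounds for the modulus on [R[i]] *)

Section ComplexModulus.
Context {R : realType}.
Implicit Types z w : R[i].

Lemma normcE_norm z : `|z| = (normc z)%:C.
Proof. by []. Qed.

Lemma normc_triangle z w : normc (z + w) <= normc z + normc w.
Proof. exact: le_normcD. Qed.

Lemma normc_opp z : normc (- z) = normc z.
Proof. exact: normcN. Qed.

Lemma normc_distC z w : normc (z - w) = normc (w - z).
Proof. by rewrite -normc_opp opprB. Qed.

Lemma normc_ge0 z : 0 <= normc z.
Proof. by rewrite -lecR -normcE_norm normr_ge0. Qed.

Lemma normc_real (a : R) : normc a%:C = `|a|.
Proof. by rewrite /= expr0n /= addr0 sqrtr_sqr. Qed.

Lemma normc_Re z : `|Re z| <= normc z.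
Proof. by rewrite -lecR -normcE_norm normc_ge_Re. Qed.

Lemma normc_Im z : `|Im z| <= normc z.
Proof.
case: z => a b /=; rewrite -sqrtr_sqr ler_wsqrtr // lerDr.
exact: sqr_ge0.
Qed.

Lemma normc_ReIm z : normc z <= `|Re z| + `|Im z|.
Proof.
case: z => a b /=; rewrite -[leRHS]ger0_norm ?addr_ge0 // -sqrtr_sqr.
rewrite ler_wsqrtr // sqrrD !real_normK ?num_real // addrAC lerDl.
by rewrite mulrn_wge0 ?mulr_ge0.
Qed.

Lemma normc_dist_normc z w : `|normc z - normc w| <= normc (z - w).
Proof.
rewrite ler_norml; apply/andP; split.
  have := normc_triangle z (w - z).
  by rewrite addrCA subrr addr0 (normc_distC w); lra.
by have := normc_triangle w (z - w); rewrite addrCA subrr addr0; lra.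
Qed.

End ComplexModulus.

(** * Finite sets of reals and their sumsets *)

Section FiniteSets.
Context {R : realType}.
Implicit Types A : set R.

Lemma finite_set_pos_lb A : finite_set A -> (forall a, A a -> 0 < a) ->
  exists2 d, 0 < d & forall a, A a -> d <= a.
Proof.
move=> /finite_seqP[s ->] {A} /=.
elim: s => [|a s IHs] s_gt0; first by exists 1.
have [a' /= a's|d d_gt0 dP] := IHs; first by apply: s_gt0; rewrite inE a's orbT.
have a_gt0 : 0 < a by apply: s_gt0; rewrite /= inE eqxx.
exists (Num.min d a) => [|b /=]; first by rewrite lt_min d_gt0.
by rewrite inE ge_min => /predU1P[->|/dP ->//]; rewrite lexx orbT.
Qed.

Lemma finite_set_max A : finite_set A -> A !=set0 ->
  exists2 m, A m & forall a, A a -> a <= m.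
Proof.
move=> /finite_seqP[s ->] {A} [a /= ].
elim: s a => [//|b s IHs] a _.
case: s IHs => [|c s] IHs.
  by exists b => [|c] /=; rewrite ?inE ?eqxx // => /eqP->.
have [|m ms mP] := IHs c; first by rewrite inE eqxx.
have [mb|bm] := leP m b.
  exists b => [|d /=]; rewrite /= inE ?eqxx // => /predU1P[->//|/mP dm].
  exact: le_trans mb.
exists m => [|d /=]; rewrite /= inE; first by rewrite ms orbT.
by move=> /predU1P[->|/mP//]; exact: ltW.
Qed.

Fixpoint sums A n : set R :=
  if n is m.+1 then [set s + a | s in sums A m & a in A] else [set 0].

Lemma finite_sums A n : finite_set A -> finite_set (sums A n).
Proof. by move=> finA; elim: n => [|n IHn] /=; [|apply: finite_image2]. Qed.

(** If all elements of [A] are at least [d > 0], a sum of more than [e / d] of them exceeds [e]; so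
    the sums of at most [e / d] terms suffice. *)
Lemma finite_additive_hull A e : finite_set A -> (forall a, A a -> 0 < a) ->
  exists S : set R, [/\ finite_set S, S 0 &
    forall s a, S s -> A a -> s + a <= e -> S (s + a)].
Proof.
move=> finA A_gt0; have [d d_gt0 dP] := finite_set_pos_lb finA A_gt0.
have sums_ge n s : sums A n s -> d *+ n <= s.
  elim: n s => [s /= -> //|n IHn _ /= [s sn [a Aa <-]]].
  by rewrite mulrSr lerD ?IHn ?dP.
pose N := Num.truncn (e / d).
exists (\bigcup_(n in `I_N.+1) sums A n); split.
- by apply: bigcup_finite => // n _; exact: finite_sums.
- by exists 0%N.
move=> s a [n nN sn] Aa sae; exists n.+1; last by exists s => //; exists a.
rewrite /= ltnS; have n_ge0 : d *+ n.+1 <= e.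
  by apply: le_trans sae; rewrite mulrSr lerD ?sums_ge ?dP.
have : n.+1%:R <= e / d by rewrite ler_pdivlMr // mulr_natl.
rewrite -truncn_ge_nat // divr_ge0 ?(ltW d_gt0) // (le_trans _ n_ge0) //.
by rewrite mulrn_wge0 // ltW.
Qed.


End FiniteSets.

(** * Calculus of controls, and rounding the control of a simple function *)

Section Controls.
Context {R : realType} {K : metricType R}.
Implicit Types (f g : K -> R[i]) (rho theta : K -> R) (e : R).

Definition controls rho f := forall x e, 0 < e ->
  \forall y \near x, normc (f y - f x) <= rho y - rho x + e.

Definition near_lsc theta := forall x e, 0 < e ->
  \forall y \near x, theta x - e <= theta y.

Lemma near_lscP theta : lower_semicontinuous (EFin \o theta) <-> near_lsc theta.
Proof.
split=> [lsc x e e_gt0|lsc x a].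
  have [|V xV VP] := lsc x (theta x - e); first by rewrite lte_fin; lra.
  by apply: filterS xV => y /VP; rewrite lte_fin; exact: ltW.
rewrite lte_fin => ax.
exists [set y | a < theta y]; last by move=> y /=; rewrite lte_fin.
have e_gt0 : 0 < (theta x - a) / 2 by lra.
by apply: filterS (lsc x _ e_gt0) => y /=; lra.
Qed.

Lemma controls_lsc rho f : controls rho f -> near_lsc rho.
Proof.
move=> cf x e e_gt0; apply: filterS (cf x e e_gt0) => y.
by have := normc_ge0 (f y - f x); lra.
Qed.

(** This is the inequality [|t| <= t + e], valid as soon as [t >= - e / 2], at
    [t = theta y - theta x]. *)
Lemma lsc_controls theta : near_lsc theta -> controls theta (fun x => (theta x)%:C).
Proof.
move=> lsc x e e_gt0; have e2_gt0 : 0 < e / 2 by lra.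
apply: filterS (lsc x _ e2_gt0) => y xy.
by rewrite -rmorphB normc_real; case: ger0P; lra.
Qed.

Lemma lsc_cst (a : R) : near_lsc (fun _ : K => a).
Proof. by move=> x e e_gt0; near=> y; lra. Unshelve. all: by end_near. Qed.

Lemma controls_lsc_add rho theta f :
  controls rho f -> near_lsc theta -> controls (fun x => rho x + theta x) f.
Proof.
move=> cf lsc x e e_gt0; have e2_gt0 : 0 < e / 2 by lra.
by apply: filterS2 (cf x _ e2_gt0) (lsc x _ e2_gt0) => y; lra.
Qed.

Lemma controls_comp (l : R[i] -> R[i]) rho f :
  (forall z w, normc (l z - l w) <= normc (z - w)) ->
  controls rho f -> controls rho (fun x => l (f x)).
Proof.
move=> l1 cf x e e_gt0; apply: filterS (cf x e e_gt0) => y.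
exact: le_trans.
Qed.

Lemma controls_add rho1 rho2 f g : controls rho1 f -> controls rho2 g ->
  controls (fun x => rho1 x + rho2 x) (fun x => f x + g x).
Proof.
move=> cf cg x e e_gt0; have e2_gt0 : 0 < e / 2 by lra.
apply: filterS2 (cf x _ e2_gt0) (cg x _ e2_gt0) => y.
by rewrite opprD addrACA; have := normc_triangle (f y - f x) (g y - g x); lra.
Qed.

Lemma controls_scale rho f a : 0 <= a -> controls rho f ->
  controls (fun x => a * rho x) (fun x => a%:C * f x).
Proof.
(* Dividing by [a + 1] instead of [a] covers [a = 0]. *)
move=> a_ge0 cf x e e_gt0; have e'_gt0 : 0 < e / (a + 1) by rewrite divr_gt0 //; lra.
apply: filterS (cf x _ e'_gt0) => y.
rewrite -mulrBr ComplexField.Normc.normcM normc_real ger0_norm // => xy.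
apply: le_trans (ler_wpM2l a_ge0 xy) _.
rewrite mulrDr mulrBr lerD2l mulrCA ger_pMr // ler_pdivrMr; lra.
Qed.

(** The error at [y] is absorbed exactly by [rho y - rho_ n y], so smallness of [rho - rho_ n] is
    needed only at the point [x]: pointwise convergence suffices. *)
Lemma controls_lim (rho_ : nat -> K -> R) (f_ : nat -> K -> R[i]) rho f :
  (forall n, controls (rho_ n) (f_ n)) ->
  (forall n x, normc (f x - f_ n x) <= rho x - rho_ n x) ->
  (forall x e, 0 < e -> exists n, rho x - rho_ n x <= e) ->
  controls rho f.
Proof.
move=> cf tail appr x e e_gt0; have e4_gt0 : 0 < e / 4 by lra.
have [n rn] := appr x _ e4_gt0; apply: filterS (cf n x _ e4_gt0) => y.
have := tail n x; rewrite normc_distC; have := tail n y.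
have := normc_triangle (f y - f_ n y + (f_ n y - f_ n x)) (f_ n x - f x).
have := normc_triangle (f y - f_ n y) (f_ n y - f_ n x).
by rewrite !addrA !subrK; lra.
Qed.

Lemma finite_range_gap g : simple_fun g -> exists2 d, 0 < d &
  forall x y, g x != g y -> d <= normc (g x - g y).
Proof.
move=> fin; have finA : finite_set
    ([set normc (z - w) | z in range g & w in range g] `&` [set d | 0 < d]).
  by apply: finite_setIl; exact: finite_image2.
have [|d d_gt0 dP] := finite_set_pos_lb finA; first by move=> a [].
exists d => // x y xy; apply: dP; split; first by exists (g x) => //; exists (g y).
rewrite /= lt_neqAle normc_ge0 andbT eq_sym; apply: contra xy => /eqP.
by move/ComplexField.Normc.eq0_normc/eqP; rewrite subr_eq0.
Qed.

(* Round [e - rho] down to a finite set that contains [0] and is closed, up to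
   [e], under adding distances between values of [g]. *)
Lemma controls_simple rho g e : simple_fun g -> controls rho g ->
  (forall x, normc (g x) <= rho x <= e) ->
  exists rho', [/\ finite_set (range rho'), controls rho' g &
    forall x, normc (g x) <= rho' x <= e].
Proof.
move=> fin cg g_le.
pose D := [set normc (z - w) | z in range g & w in range g].
have finD : finite_set D by exact: finite_image2.
have DP x y : D (normc (g x - g y)) by exists (g x) => //; exists (g y).
have D_ge0 d : D d -> 0 <= d by move=> [z _ [w _ <-]]; exact: normc_ge0.
have [S [finS S0 SD]] : exists S : set R, [/\ finite_set S, S 0 &
    forall s a, S s -> D a -> s + a <= e -> S (s + a)].
  (* The hull is taken over the nonzero distances only; adding a zero distance changes nothing. *)
  have [||S [finS S0 SP]] := @finite_additive_hull R (D `&` [set d | 0 < d]) e.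
  - exact: finite_setIl.
  - by move=> a [].
  exists S; split=> // s a Ss Da; have := D_ge0 _ Da.
  rewrite le_eqVlt => /predU1P[<-|a_gt0]; first by rewrite addr0.
  exact: SP.
have sigma_ge0 x : 0 <= e - rho x by have /andP[_] := g_le x; lra.
have floorS x : exists s, [/\ S s, s <= e - rho x &
    forall t, S t -> t <= e - rho x -> t <= s].
  have [||s [Ss sx] sP] := @finite_set_max R (S `&` [set s | s <= e - rho x]).
  - exact: finite_setIl.
  - by exists 0; split=> //=.
  by exists s; split=> // t St tx; apply: sP.
have [sigma sigmaP] := choice floorS.
exists (fun x => e - sigma x); split.
- apply: (@sub_finite_set _ _ [set e - s | s in S]); last exact: finite_image.
  by move=> _ [x _ <-]; exists (sigma x) => //; have [] := sigmaP x.
- move=> x eta eta_gt0.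
  (* [T] is finite, so its elements above [e - rho x] exceed it by at least some [d]. Near [x],
     [sigma y + normc (g y - g x)] exceeds [e - rho x] by at most [d / 2], hence not at all, and
     maximality of [sigma x] applies. *)
  pose T := [set s + d | s in S & d in D].
  have [||d d_gt0 dP] := @finite_set_pos_lb R
      ([set t - (e - rho x) | t in T] `&` [set r | 0 < r]).
  - by apply/finite_setIl/finite_image; exact: finite_image2.
  - by move=> a [].
  have d2_gt0 : 0 < d / 2 by lra.
  apply: filterS (cg x _ d2_gt0) => y xy.
  have [Sy sy _] := sigmaP y; have [Sx sx sxP] := sigmaP x.
  have tT : T (sigma y + normc (g y - g x)).
    by exists (sigma y) => //; exists (normc (g y - g x)).
  suff : sigma y + normc (g y - g x) <= sigma x by lra.
  have t_le : sigma y + normc (g y - g x) <= e - rho x.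
    rewrite leNgt; apply/negP => t_gt.
    have : d <= sigma y + normc (g y - g x) - (e - rho x).
      apply: dP; split; last by rewrite /= subr_gt0.
      by exists (sigma y + normc (g y - g x)).
    by lra.
  apply: sxP => //; apply: SD => //; apply: (le_trans t_le).
  by have := normc_ge0 (g x); have /andP[] := g_le x; lra.
- move=> x; have [Sx sx sxP] := sigmaP x; have /andP[gx _] := g_le x.
  by have := sxP _ S0 (sigma_ge0 x); lra.
Qed.

End Controls.

(** * Baire's theorem: lower semi-continuous functions as series of continuous ones *)

Section LscSeries.
Context {R : realType} {K : metricType R}.
Implicit Types (theta : K -> R).

(** For nonnegative [theta] this is the Pasch-Hausdorff envelope, the greatest [n]-Lipschitz
    minorant of [theta]. *)
Definition inf_convolution theta n x : R :=
  inf (range (fun y => theta y + n%:R * mdist x y)).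

Lemma inf_convolution_le theta n x y : (forall z, 0 <= theta z) ->
  inf_convolution theta n x <= theta y + n%:R * mdist x y.
Proof.
move=> theta_ge0; apply: ge_inf; last by exists y.
by exists 0 => _ [z _ <-]; rewrite addr_ge0 ?mulr_ge0 ?mdist_ge0.
Qed.

Lemma le_inf_convolution theta n x a :
  (forall y, a <= theta y + n%:R * mdist x y) -> a <= inf_convolution theta n x.
Proof.
move=> aP; apply: lb_le_inf => [|_ [y _ <-]//].
by exists (theta x + n%:R * mdist x x), x.
Qed.

Lemma inf_convolution_lipschitz theta n x y : (forall z, 0 <= theta z) ->
  `|inf_convolution theta n x - inf_convolution theta n y| <= n%:R * mdist x y.
Proof.
move=> theta_ge0.
have le_add a b :
    inf_convolution theta n a - n%:R * mdist a b <= inf_convolution theta n b.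
  apply: le_inf_convolution => z; rewrite lerBlDr.
  apply: (le_trans (@inf_convolution_le _ n a z theta_ge0)).
  rewrite -addrA -mulrDr lerD2l ler_wpM2l // addrC; exact: metric_triangle.
have := le_add x y; have := le_add y x; rewrite (metric_sym y x).
by rewrite ler_norml; lra.
Qed.

Lemma inf_convolution_continuous theta n : (forall z, 0 <= theta z) ->
  continuous (inf_convolution theta n).
Proof.
move=> theta_ge0 x; apply/cvgrPdist_le => e e_gt0.
have d_gt0 : 0 < e / n.+1%:R by rewrite divr_gt0.
apply: filterS (nbhsx_ballx x _ d_gt0) => y; rewrite ballEmdist /= => xy.
apply: (le_trans (inf_convolution_lipschitz n x y theta_ge0)).
have : n.+1%:R * mdist x y <= e by rewrite mulrC -ler_pdivlMr // ltW.
by apply: le_trans; rewrite ler_wpM2r ?mdist_ge0 // ler_nat.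
Qed.

(** The Lipschitz envelopes increase to [theta]; their successive differences are the terms of the
    series. *)
Lemma lsc_continuous_series theta e : near_lsc theta ->
  (forall x, 0 <= theta x <= e) ->
  exists t : nat -> K -> R, [/\ forall n, continuous (t n),
    forall n x, 0 <= t n x, forall n x, \sum_(0 <= j < n) t j x <= theta x &
    forall x, series (t ^~ x) @ \oo --> theta x].
Proof.
move=> lsc theta_le; have theta_ge0 x : 0 <= theta x by have /andP[] := theta_le x.
have theta_lee x : theta x <= e by have /andP[] := theta_le x.
(* Starting from 0 makes the telescoping sum equal to [T n x] itself. *)
pose T n x := if n is m.+1 then inf_convolution theta m x else 0.
have T_le n x : T n x <= theta x.
  case: n => [//|n] /=; have := @inf_convolution_le theta n x x theta_ge0.
  by rewrite mdistxx mulr0 addr0.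
have sumT n x : \sum_(0 <= j < n) (T j.+1 x - T j x) = T n x.
  by rewrite telescope_sumr // subr0.
exists (fun n x => T n.+1 x - T n x); split.
- move=> n; have Tc m : continuous (T m).
    by case: m => [|m]; [exact: cst_continuous|exact: inf_convolution_continuous].
  by move=> x; apply: cvgB; exact: Tc.
- move=> n x; rewrite subr_ge0; case: n => [|n] /=.
    by apply: le_inf_convolution => y; rewrite addr_ge0 ?mulr_ge0 ?mdist_ge0.
  apply: le_inf_convolution => y.
  apply: (le_trans (@inf_convolution_le _ n x y theta_ge0)).
  by rewrite lerD2l ler_wpM2r ?mdist_ge0 // ler_nat.
- by move=> n x; rewrite sumT.
move=> x; rewrite (_ : series _ = T ^~ x); last by apply/funext => n; exact: sumT.
apply/cvgrPdist_le => eta eta_gt0.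
have /nbhs_ballP[d /= d_gt0 dP] := lsc x _ eta_gt0.
(* One successor is for truncation, the other because [T n.+1] is the envelope of constant [n].
   Within [d] of [x] semi-continuity bounds [theta y] below; farther away the penalty alone is at
   least [e]. *)
exists (Num.truncn (e / d)).+2 => // -[//|n] /=; rewrite ltnS => nN.
have Tx := T_le n.+1 x; rewrite ger0_norm ?subr_ge0 // lerBlDr addrC -lerBlDr.
apply: le_inf_convolution => y.
have [xy|xy] := ltP (mdist x y) d.
  have := dP y; rewrite ballEmdist /= => /(_ xy) le_y.
  by apply: (le_trans le_y); rewrite lerDl mulr_ge0 ?mdist_ge0.
have le_nd : e <= n%:R * d.
  rewrite -ler_pdivrMr //; apply/ltW/(lt_le_trans (truncnS_gt _)).
  by rewrite ler_nat.
have : n%:R * d <= n%:R * mdist x y by rewrite ler_wpM2l.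
by have := theta_lee x; have := theta_ge0 y; lra.
Qed.

End LscSeries.

(** * Limits in [R[i]] through the real modulus *)

Section ComplexLimits.
Context {R : realType}.

(** In the order of [R[i]] a positive element is real, so real tolerances suffice. *)
Lemma cvg_normcP {T : Type} (F : set_system T) {FF : Filter F}
    (u : T -> R[i]) (l : R[i]) :
  ((u : T -> R[i]^o) @ F --> (l : R[i]^o)) <->
  forall e : R, 0 < e -> \forall t \near F, normc (l - u t) <= e.
Proof.
rewrite cvgrPdist_le; split=> [ul e e_gt0|ul [a b]].
  have := ul e%:C; rewrite ltcR => /(_ e_gt0); apply: filterS => t.
  by rewrite [X in X <= _]normcE_norm lecR.
rewrite ltcE /= => /andP[/eqP b0 a_gt0]; apply: filterS (ul a a_gt0) => t.
by rewrite [X in _ -> X <= _]normcE_norm -lecR b0.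
Qed.

Lemma cvg_complex {T : Type} (F : set_system T) {FF : Filter F}
    (u v : T -> R) (a b : R) : u @ F --> a -> v @ F --> b ->
  ((fun t => u t +i* v t : R[i]^o) @ F --> (a +i* b : R[i]^o)).
Proof.
move=> /cvgrPdist_le ua /cvgrPdist_le vb; apply/cvg_normcP => e e_gt0.
have e2_gt0 : 0 < e / 2 by lra.
apply: filterS2 (ua _ e2_gt0) (vb _ e2_gt0) => t uat vbt.
apply: (le_trans (normc_ReIm _)) => /=; lra.
Qed.

End ComplexLimits.

(** * Comparison of the [D]-norm with bounded controls *)

Section DNorm.
Context {R : realType} {K : metricType R}.
Implicit Types (f g : K -> R[i]) (rho theta : K -> R) (e : R).

(** A control sees only oscillation, since constants are controlled by 0; requiring
    [normc (f x) <= rho x] brings in the sup norm. *)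
Definition D_le f e :=
  exists2 rho, controls rho f & forall x, normc (f x) <= rho x <= e.

(** The control is the pointwise supremum of the [s_ n]; telescoping the increments gives the tail
    bound that [controls_lim] requires. It serves both for [D_series] and for limits of simple
    functions. *)
Lemma controls_series (s_ : nat -> K -> R) (f_ : nat -> K -> R[i]) f e :
  (forall n, controls (s_ n) (f_ n)) ->
  (forall n x, normc (f_ n.+1 x - f_ n x) <= s_ n.+1 x - s_ n x) ->
  (forall n x, s_ n x <= e) ->
  (forall x d, 0 < d -> \forall n \near \oo, normc (f x - f_ n x) <= d) ->
  exists rho, [/\ controls rho f,
    forall n x, normc (f x - f_ n x) <= rho x - s_ n x,
    forall x c, (forall n, s_ n x <= c) -> rho x <= c &
    forall x d, 0 < d -> exists n, rho x - s_ n x <= d].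
Proof.
move=> cf f_s s_le f_cvg; pose rho x := sup (range (s_ ^~ x)).
have s_rho n x : s_ n x <= rho x.
  by apply: ub_le_sup; [exists e => _ [m _ <-]|exists n].
have f_dist n m x : normc (f_ (n + m)%N x - f_ n x) <= s_ (n + m)%N x - s_ n x.
  elim: m => [|m IHm]; first by rewrite addn0 !subrr ComplexField.Normc.normc0.
  rewrite addnS; have := f_s (n + m)%N x.
  have := normc_triangle (f_ (n + m).+1 x - f_ (n + m)%N x)
    (f_ (n + m)%N x - f_ n x).
  by rewrite addrA subrK; lra.
have tail n x : normc (f x - f_ n x) <= rho x - s_ n x.
  apply/ler_addgt0Pr => d d_gt0.
  have [N _ NP] := f_cvg x _ d_gt0.
  have /= := NP (n + N)%N; rewrite leq_addl => /(_ isT).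
  have := f_dist n N x; have := s_rho (n + N)%N x.
  have := normc_triangle (f x - f_ (n + N)%N x) (f_ (n + N)%N x - f_ n x).
  by rewrite addrA subrK; lra.
have appr x d : 0 < d -> exists n, rho x - s_ n x <= d.
  move=> d_gt0; have [|_ [n _ <-]] := @sup_adherent R (range (s_ ^~ x)) d d_gt0.
    by split; [exists (s_ 0%N x), 0%N|exists e => _ [m _ <-]].
  by exists n; rewrite lerBlDr -lerBlDl ltW.
exists rho; split=> //; first exact: controls_lim cf tail appr.
by move=> x c sc; apply: ge_sup => [|_ [n _ <-]//]; exists (s_ 0%N x), 0%N.
Qed.

Lemma continuous_controls f : continuous (f : K -> R[i]^o) ->
  controls (fun x => normc (f x)) f.
Proof.
move=> fc x e e_gt0; have e2_gt0 : 0 < e / 2 by lra.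
have /cvg_normcP/(_ _ e2_gt0) := fc x; apply: filterS => y.
rewrite normc_distC; have := normc_dist_normc (f y) (f x).
by rewrite ler_norml => /andP[]; lra.
Qed.

Lemma Dnorm_lt_D_le f e : (Dnorm f < e%:E)%E -> D_le f e.
Proof.
move=> /ereal_inf_lt[_ [phi [phi_c _ phi_cvg] <-]].
rewrite /sup_abs_sum gt_max => /andP[_ phi_lt].
pose s n x := \sum_(0 <= j < n) normc (phi j x).
have s_le n x : s n x <= e.
  rewrite -lee_fin -sumEFin; apply: le_trans (ltW phi_lt).
  apply: le_trans (ereal_sup_ubound _); last by exists x.
  by apply: nneseries_lim_ge => j _ _; rewrite lee_fin normc_ge0.
have [n|n x|x d d_gt0|rho [cf tail rho_le _]] :=
    @controls_series s (fun n x => \sum_(0 <= j < n) phi j x) f e _ _ s_le.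
- elim: n => [|n IHn].
    move=> x d d_gt0; near=> y.
    by rewrite !big_nil subrr ComplexField.Normc.normc0 /s !big_nil; lra.
  have -> : s n.+1 = fun x => s n x + normc (phi n x).
    by apply/funext => x; rewrite /s big_nat_recr.
  have -> : (fun x => \sum_(0 <= j < n.+1) phi j x) =
            fun x => \sum_(0 <= j < n) phi j x + phi n x.
    by apply/funext => x; rewrite big_nat_recr.
  exact: controls_add IHn (continuous_controls (phi_c n)).
- by rewrite /s !big_nat_recr //= !(addrAC _ _ (- _)) !subrr !add0r.
- by have /cvg_normcP := phi_cvg x; exact.
exists rho => // x; rewrite rho_le ?andbT //.
(* The partial sums of index 0 vanish, so the tail bound there reads [normc (f x) <= rho x]. *)
by have := tail 0%N x; rewrite /s !big_nil !subr0.
Unshelve. all: by end_near. Qed.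

(** Up to [e], any fall of [l (f y)] below [l (f x)] is compensated by the rise of [rho]. *)
Lemma controls_lsc_real (l : R[i] -> R) rho f :
  (forall z w, `|l z - l w| <= normc (z - w)) ->
  controls rho f -> near_lsc (fun x => rho x + l (f x)).
Proof.
move=> l1 cf x e e_gt0; apply: filterS (cf x e e_gt0) => y.
by have := l1 (f y) (f x); rewrite ler_norml => /andP[]; lra.
Qed.

Lemma Re_lipschitz (z w : R[i]) : `|Re z - Re w| <= normc (z - w).
Proof. by case: z w => a b [c d]; exact: (normc_Re (a +i* b - c +i* d)). Qed.

Lemma Im_lipschitz (z w : R[i]) : `|Im z - Im w| <= normc (z - w).
Proof. by case: z w => a b [c d]; exact: (normc_Im (a +i* b - c +i* d)). Qed.

(** In [f = (rho + Re f - rho) + i (rho + Im f - rho)] all four functions are nonnegative, with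
    bounds [2 e], [e], [2 e], [e]; these add up to [6 e]. The sign of [e] matters for empty [K],
    where [D_le f e] is vacuous. *)
Lemma D_le_Dnorm f e : 0 <= e -> D_le f e -> (Dnorm f <= (6 * e)%:E)%E.
Proof.
move=> e_ge0 [rho cf f_le].
have f_rho x : normc (f x) <= rho x by have /andP[] := f_le x.
have rho_e x : rho x <= e by have /andP[] := f_le x.
have rho_ge0 x : 0 <= rho x := le_trans (normc_ge0 _) (f_rho x).
have le_normc (l : R[i] -> R) x : (forall z, `|l z| <= normc z) ->
    0 <= rho x + l (f x) <= 2 * e.
  by move=> /(_ (f x)); have := f_rho x; have := rho_e x; rewrite ler_norml; lra.
have [t [tc t_ge0 t_le t_cvg]] := lsc_continuous_series
  (controls_lsc_real Re_lipschitz cf) (fun x => le_normc _ x normc_Re).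
have [u [uc u_ge0 u_le u_cvg]] := lsc_continuous_series
  (controls_lsc_real Im_lipschitz cf) (fun x => le_normc _ x normc_Im).
have [|v [vc v_ge0 v_le v_cvg]] := @lsc_continuous_series _ _ rho e (controls_lsc cf).
  by move=> x; rewrite rho_ge0 rho_e.
pose phi j x := (t j x - v j x) +i* (u j x - v j x).
have sup_le : (sup_abs_sum phi <= (6 * e)%:E)%E.
  rewrite /sup_abs_sum ge_max lee_fin mulr_ge0 // andTb.
  apply: ge_ereal_sup => _ [x _ <-]; apply: lime_le.
    by apply: is_cvg_nneseries => j _ _; rewrite lee_fin; exact: normc_ge0.
  near=> n; rewrite sumEFin lee_fin.
  apply: (@le_trans _ _ (\sum_(0 <= j < n) (t j x + v j x + (u j x + v j x)))).
    apply: ler_sum => j _; apply: (le_trans (normc_ReIm _)) => /=.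
    apply: lerD; apply: (le_trans (ler_normB _ _));
    by rewrite !ger0_norm.
  rewrite !big_split /=; have := t_le n x; have := u_le n x; have := v_le n x.
  have := le_normc _ x normc_Re; have := le_normc _ x normc_Im.
  by have := rho_e x; lra.
apply: ge_ereal_inf; exists (sup_abs_sum phi) => //; exists phi => //; split.
- move=> j x; apply: cvg_complex; apply: cvgB;
  by [exact: tc|exact: vc|exact: uc].
- exact: (le_lt_trans sup_le (ltry _)).
- move=> x.
  have -> : series (fun j => phi j x : R[i]^o) =
      fun n => (series (t ^~ x) n - series (v ^~ x) n) +i*
               (series (u ^~ x) n - series (v ^~ x) n).
    apply/funext => n; rewrite /series /=; elim: n => [|n IHn].
      by rewrite !big_nil subrr.
    rewrite !big_nat_recr //= IHn; apply/eqP; rewrite eq_complex /=.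
    by apply/andP; split; apply/eqP; ring.
  have -> : f x = (rho x + Re (f x) - rho x) +i* (rho x + Im (f x) - rho x).
    by rewrite !(addrC (rho x)) !addrK; case: (f x).
  by apply: cvg_complex; apply: cvgB.
Unshelve. all: by end_near. Qed.

Lemma bounded_lscP theta : bounded_lsc theta <->
  (exists M, forall x, `|theta x| <= M) /\ near_lsc theta.
Proof.
split=> [[[M [_ MP]] /near_lscP lsc]|[[M MP] /near_lscP lsc]]; split=> //.
  (* [bounded_fun] provides only the bounds strictly above [M]. *)
  by exists (M + 1) => x; apply: MP => //; lra.
by exists M; split=> [|N MN x _ /=]; [exact: num_real|exact: le_trans (ltW MN)].
Qed.

Lemma controls_bounded_lsc (l : R[i] -> R) rho f e :
  (forall z w, `|l z - l w| <= normc (z - w)) -> (forall z, `|l z| <= normc z) ->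
  controls rho f -> (forall x, normc (f x) <= rho x <= e) ->
  bounded_lsc (fun x => rho x + l (f x)).
Proof.
move=> lip l1 cf f_le; apply/bounded_lscP.
split; last exact: controls_lsc_real lip cf.
exists (2 * e) => x; have := l1 (f x); have := f_le x.
by rewrite !ler_norml; lra.
Qed.

Lemma control_bounded_lsc rho f e : controls rho f ->
  (forall x, normc (f x) <= rho x <= e) -> bounded_lsc rho.
Proof.
move=> cf f_le; apply/bounded_lscP; split; last exact: controls_lsc cf.
by exists e => x; have := f_le x; have := normc_ge0 (f x); rewrite ler_norml; lra.
Qed.

Lemma DKP f : DK f <-> exists e, D_le f e.
Proof.
split=> [[p1 [p2 [p3 [p4 [/bounded_lscP[[M1 b1] l1] /bounded_lscP[[M2 b2] l2]
    /bounded_lscP[[M3 b3] l3] /bounded_lscP[[M4 b4] l4] ->]]]]]|[e [rho cf f_le]]].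
  pose M := M1 + M2 + (M3 + M4); exists (3 * M).
  (* The sum of the four functions controls [f] but may be as low as [- M], while [normc (f x)] may
     reach [M]; the shift by [2 * M] restores domination. *)
  exists (fun x => p1 x + p2 x + (p3 x + p4 x) + 2 * M).
    move=> x e e_gt0; have e8_gt0 : 0 < e / 8 by lra.
    near=> y; have y1 : p1 x - e / 8 <= p1 y by near: y; exact: l1.
    have y2 : p2 x - e / 8 <= p2 y by near: y; exact: l2.
    have y3 : p3 x - e / 8 <= p3 y by near: y; exact: l3.
    have y4 : p4 x - e / 8 <= p4 y by near: y; exact: l4.
    apply: (le_trans (normc_ReIm _)); rewrite /complex_diff /=.
    have : `|p1 y - p2 y - (p1 x - p2 x)| <= p1 y + p2 y - (p1 x + p2 x) + e / 2.
      by rewrite ler_norml; lra.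
    have : `|p3 y - p4 y - (p3 x - p4 x)| <= p3 y + p4 y - (p3 x + p4 x) + e / 2.
      by rewrite ler_norml; lra.
    by lra.
  move=> x; have := normc_ReIm (complex_diff p1 p2 p3 p4 x) => /=.
  have := ler_normB (p1 x) (p2 x); have := ler_normB (p3 x) (p4 x).
  have := b1 x; have := b2 x; have := b3 x; have := b4 x.
  have := ler_norm (p1 x); have := ler_norm (p2 x).
  have := ler_norm (p3 x); have := ler_norm (p4 x).
  have := ler_norm (- p1 x); have := ler_norm (- p2 x).
  have := ler_norm (- p3 x); have := ler_norm (- p4 x).
  by rewrite !normrN /M; lra.
have rho_lsc := control_bounded_lsc cf f_le.
exists (fun x => rho x + Re (f x)), rho, (fun x => rho x + Im (f x)), rho; split=> //.
- exact: controls_bounded_lsc Re_lipschitz (@normc_Re R) cf f_le.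
- exact: controls_bounded_lsc Im_lipschitz (@normc_Im R) cf f_le.
apply/funext => x; rewrite /complex_diff !(addrC (rho x)) !addrK.
by case: (f x).
Unshelve. all: by end_near. Qed.

Lemma D_le_add f g a b : D_le f a -> D_le g b -> D_le (fun x => f x + g x) (a + b).
Proof.
move=> [r cf f_le] [s cg g_le]; exists (fun x => r x + s x).
  exact: controls_add.
move=> x; have := normc_triangle (f x) (g x).
by have := f_le x; have := g_le x; lra.
Qed.

Lemma D_le_comp (l : R[i] -> R[i]) f e : l 0 = 0 ->
  (forall z w, normc (l z - l w) <= normc (z - w)) ->
  D_le f e -> D_le (fun x => l (f x)) e.
Proof.
move=> l0 l1 [rho cf f_le]; exists rho; first exact: controls_comp cf.
by move=> x; have := l1 (f x) 0; have := f_le x; rewrite l0 !subr0; lra.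
Qed.

Lemma D_le_opp f e : D_le f e -> D_le (fun x => - f x) e.
Proof.
apply: D_le_comp => [|z w]; first exact: oppr0.
by rewrite -opprD normc_opp.
Qed.

(** The constant 6 between [Dnorm] and [D_le] is harmless for a closure, and a single approximation
    already puts [f] in [DK]. *)
Lemma SDKP f : SDK f <-> forall e, 0 < e -> exists g, [/\ simple_fun g,
  exists b, D_le g b & D_le (fun x => f x - g x) e].
Proof.
split=> [[_ fP] e /fP[g [g_s /DKP Dg]] /Dnorm_lt_D_le fg|fP]; first by exists g.
split.
  apply/DKP; have [//|g [_ [b Db] Dfg]] := fP 1.
  exists (1 + b); have := D_le_add Dfg Db.
  by congr D_le; apply/funext => x; rewrite subrK.
(* Since [6 * (e / 7) < e], the strict inequality is recovered. *)
move=> e e_gt0; have e7_gt0 : 0 < e / 7 by lra.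
have [g [g_s Dg Dfg]] := fP _ e7_gt0; exists g; split=> //; first exact/DKP.
apply: le_lt_trans (D_le_Dnorm (ltW e7_gt0) Dfg) _.
by rewrite lte_fin; lra.
Qed.

End DNorm.

(** * Closure properties and controls of strong [D]-functions *)

Section StrongD.
Context {R : realType} {K : metricType R}.
Implicit Types (f g : K -> R[i]) (rho theta : K -> R) (e : R).

Lemma simple_fun_comp (l : R[i] -> R[i]) g :
  simple_fun g -> simple_fun (fun x => l (g x)).
Proof. by move=> g_s; apply: (finite_image11 (fun a _ => l a) g_s g_s). Qed.

Lemma SDK_add f g : SDK f -> SDK g -> SDK (fun x => f x + g x).
Proof.
move=> /SDKP fP /SDKP gP; apply/SDKP => e e_gt0; have e2_gt0 : 0 < e / 2 by lra.
have [f' [f's [a Df'] Dff']] := fP _ e2_gt0.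
have [g' [g's [b Dg'] Dgg']] := gP _ e2_gt0.
exists (fun x => f' x + g' x); split.
- exact: finite_image11.
- by exists (a + b); exact: D_le_add.
have := D_le_add Dff' Dgg'; rewrite -splitr; congr D_le.
by apply/funext => x; rewrite opprD addrACA.
Qed.

(** Meant for the real and imaginary parts, which are additive contractions. *)
Lemma SDK_comp (l : R[i] -> R[i]) f :
  (forall z w, l (z - w) = l z - l w) -> (forall z, normc (l z) <= normc z) ->
  SDK f -> SDK (fun x => l (f x)).
Proof.
move=> lB l1 /SDKP fP; apply/SDKP => e e_gt0.
have l0 : l 0 = 0 by rewrite -[X in l X](subrr 0) lB subrr.
have lip z w : normc (l z - l w) <= normc (z - w) by rewrite -lB.
have [g [g_s [b Dg] Dfg]] := fP _ e_gt0; exists (fun x => l (g x)); split.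
- exact: simple_fun_comp.
- by exists b; exact: D_le_comp.
by have := D_le_comp l0 lip Dfg; congr D_le; apply/funext => x; rewrite lB.
Qed.

(* With [f = g + h] and [f' = g + h'], where [g], [f'] are simple, the variation
   of [|f| - |f'|] on a set where [g] is constant is at most that of [h] plus
   that of [h'], both small; each jump of [g] contributes at most
   [2 * sup |f - f'|], which is chosen small compared with the number of jumps,
   that is, with [rg / d]. *)
Lemma SDK_normc f : SDK f -> SDK (fun x => (normc (f x))%:C).
Proof.
move=> /SDKP fP; apply/SDKP => e e_gt0; have e4_gt0 : 0 < e / 4 by lra.
have [g [g_s [b [rg cg g_le]] Dfg]] := fP _ e4_gt0.
have [d d_gt0 dP] := finite_range_gap g_s.
(* This makes [a * rg] at most [e / 4]. *)
pose a := e / 4 / (`|b| + 1).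
have b1_gt0 : 0 < `|b| + 1 by have := normr_ge0 b; lra.
have a_gt0 : 0 < a by rewrite divr_gt0.
have ab : a * b <= e / 4.
  rewrite /a mulrAC ler_pdivrMr // ler_wpM2l //; first exact: ltW.
  by have := ler_norm b; lra.
(* At a jump of [g] the difference of moduli varies by at most [2 * delta <= a * d / 2], which the
   rise of [a * rg] must pay for. *)
pose delta := Num.min (a * d / 4) (e / 4).
have delta_gt0 : 0 < delta by rewrite lt_min e4_gt0 divr_gt0 // mulr_gt0.
have delta_e : delta <= e / 4 by rewrite ge_min lexx orbT.
have delta_ad : delta <= a * d / 4 by rewrite ge_min lexx.
have [f' [f's [b' Df'] Dff']] := fP _ delta_gt0.
have [rh' ch' h'_le] : D_le (fun x => f' x - g x) (delta + e / 4).
  have := D_le_add (D_le_opp Dff') Dfg; congr D_le; apply/funext => x.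
  by rewrite opprB addrA subrK.
have [rh ch h_le] := Dfg.
have lip z w : normc ((normc z)%:C - (normc w)%:C : R[i]) <= normc (z - w).
  by rewrite -rmorphB normc_real normc_dist_normc.
have normcC0 : (normc (0 : R[i]))%:C = 0 :> R[i] by rewrite ComplexField.Normc.normc0.
exists (fun x => (normc (f' x))%:C); split.
- exact: (simple_fun_comp (fun z => (normc z)%:C) f's).
- by exists b'; exact: (D_le_comp (l := fun z => (normc z)%:C) normcC0 lip Df').
have u_le x : normc ((normc (f x))%:C - (normc (f' x))%:C : R[i]) <= delta.
  by have [r _ /(_ x)] := Dff'; have := lip (f x) (f' x); lra.
(* The bounds add up to [e / 4 + (delta + e / 4) + e / 4 <= e]. *)
exists (fun x => rh x + rh' x + a * rg x); last first.
  move=> x; have := lip (f x) (f' x).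
  have := normc_triangle (f x - g x) (g x - f' x); rewrite addrA subrK (normc_distC (g x)).
  have := h_le x; have := h'_le x; have /andP[g_rg rg_b] := g_le x.
  have rg_ge0 : 0 <= rg x := le_trans (normc_ge0 _) g_rg.
  have : 0 <= a * rg x by rewrite mulr_ge0 // ltW.
  have : a * rg x <= a * b by rewrite ler_wpM2l // ltW.
  by lra.
have cag := controls_scale (ltW a_gt0) cg.
move=> x eta eta_gt0; have eta8_gt0 : 0 < eta / 8 by lra.
have d2_gt0 : 0 < d / 2 by lra.
near=> y.
have hy : normc (f y - g y - (f x - g x)) <= rh y - rh x + eta / 8.
  by near: y; exact: ch.
have h'y : normc (f' y - g y - (f' x - g x)) <= rh' y - rh' x + eta / 8.
  by near: y; exact: ch'.
have gy : normc (g y - g x) <= rg y - rg x + d / 2 by near: y; exact: cg.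
have agy : normc (a%:C * g y - a%:C * g x) <= a * rg y - a * rg x + eta / 8.
  by near: y; exact: cag.
have := normc_ge0 (a%:C * g y - a%:C * g x).
have := normc_ge0 (f y - g y - (f x - g x)).
have := normc_ge0 (f' y - g y - (f' x - g x)).
move: (u_le x) (u_le y); rewrite -!rmorphB !normc_real.
have [gyx|gyx] := eqVneq (g y) (g x).
  have := normc_dist_normc (f y) (f x); have := normc_dist_normc (f' y) (f' x).
  move: agy hy h'y; rewrite gyx !opprB !addrA !subrK !ler_norml.
  by lra.
(* At a jump, [d <= rg y - rg x + d / 2], so [rg] rises by at least [d / 2]. *)
have := dP _ _ gyx => d_le.
have /(ler_wpM2l (ltW a_gt0)) : d / 2 <= rg y - rg x by lra.
rewrite mulrBr mulrA !ler_norml.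
by lra.
Unshelve. all: by end_near. Qed.

Lemma lsc_sum (r : nat -> K -> R) n m : (forall k, near_lsc (r k)) ->
  near_lsc (fun x => \sum_(n <= k < n + m) r k x).
Proof.
move=> lsc; elim: m => [|m IHm].
  rewrite (_ : (fun _ => _) = fun=> 0); first exact: lsc_cst.
  by apply/funext => x; rewrite addn0 big_geq.
rewrite (_ : (fun _ => _) =
    fun x => \sum_(n <= k < n + m) r k x + r (n + m)%N x); last first.
  by apply/funext => x; rewrite addnS big_nat_recr ?leq_addr.
exact: controls_lsc (controls_lsc_add (lsc_controls IHm) (lsc _)).
Qed.

Lemma lsc_sup (theta_ : nat -> K -> R) theta : (forall n, near_lsc (theta_ n)) ->
  (forall n x, theta_ n x <= theta x) ->
  (forall x e, 0 < e -> exists n, theta x - theta_ n x <= e) -> near_lsc theta.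
Proof.
move=> lsc le_theta appr x e e_gt0; have e2_gt0 : 0 < e / 2 by lra.
have [n xn] := appr x _ e2_gt0; apply: filterS (lsc n x _ e2_gt0) => y.
by have := le_theta n y; lra.
Qed.

Lemma half_pow_small e : 0 < e -> \forall n \near \oo, 2^-1 ^+ n <= e.
Proof.
move=> e_gt0; exists (Num.truncn e^-1).+1 => // n /= en.
rewrite exprVn invf_ple ?posrE ?exprn_gt0 //.
apply/ltW/(lt_le_trans (truncnS_gt _)); rewrite -natrX ler_nat.
exact: leq_trans en (ltnW (ltn_expl _ _)).
Qed.

(** The [s n] below are simple and approximate [rho] in [D_le], because [rho - s n] is small,
    nonnegative and lower semi-continuous, hence its own control. *)
Lemma SDK_controls f : SDK f -> exists rho, [/\ controls rho f,
  exists e, forall x, normc (f x) <= rho x <= e & SDK (fun x => (rho x)%:C)].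
Proof.
move=> /SDKP fP; pose h n : R := 2^-1 ^+ n.
have h_gt0 n : 0 < h n by rewrite exprn_gt0 // invr_gt0.
have hS n : h n.+1 = h n / 2 by rewrite /h exprSr.
have [G GP] := choice (fun n => fP _ (h_gt0 n)).
have [g0s [b [r0' cg0 g0_le]] _] := GP 0%N.
have [r0 [r0s cr0 r0_le]] := controls_simple g0s cg0 g0_le.
have stepP n : exists r, [/\ finite_set (range r),
    controls r (fun x => G n.+1 x - G n x) &
    forall x, normc (G n.+1 x - G n x) <= r x <= 2 * h n].
  have [Gs _ DG] := GP n; have [GSs _ DGS] := GP n.+1.
  have [r' cr' r'_le] : D_le (fun x => G n.+1 x - G n x) (h n.+1 + h n).
    have := D_le_add (D_le_opp DGS) DG; congr D_le; apply/funext => x.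
    by rewrite opprB addrA subrK.
  apply: (controls_simple (finite_image11 (fun z w => z - w) GSs Gs) cr') => x.
  (* The bound [h n.+1 + h n] is three halves of [h n]. *)
  by have := r'_le x; have := h_gt0 n; rewrite hS; lra.
have [r rP] := choice stepP.
pose s n x := r0 x + \sum_(0 <= k < n) r k x.
have s_S n x : s n.+1 x = s n x + r n x by rewrite /s big_nat_recr //= addrA.
have s_D n m x : s (n + m)%N x = s n x + \sum_(n <= k < n + m) r k x.
  by rewrite /s -addrA -big_cat_nat // leq_addr.
have r_ge0 n x : 0 <= r n x.
  by have [_ _ /(_ x)] := rP n; have := normc_ge0 (G n.+1 x - G n x); lra.
(* Each increment is at most [2 * h k = 4 * h k - 4 * h k.+1], which telescopes. *)
have s_le n m x : s (n + m)%N x <= s n x + 4 * h n - 4 * h (n + m)%N.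
  elim: m => [|m IHm]; first by rewrite addn0 addrK.
  by rewrite addnS s_S hS; have [_ _ /(_ x)] := rP (n + m)%N; lra.
have s_homo n m x : s n x <= s (n + m)%N x.
  by rewrite s_D lerDl sumr_ge0.
have s_bound n x : s n x <= b + 4.
  have := s_le 0%N n x; rewrite add0n /s big_nil addr0.
  by have := r0_le x; have := h_gt0 n; have : h 0%N = 1 by []; lra.
have cs n : controls (s n) (G n).
  elim: n => [|n IHn].
    rewrite (_ : s 0%N = r0) //.
    by apply/funext => x; rewrite /s big_nil addr0.
  have [_ cr _] := rP n; have := controls_add IHn cr.
  by congr controls; apply/funext => x; rewrite ?s_S // addrC subrK.
have [n x|x e e_gt0|rho [cf tail rho_le appr]] := controls_series cs _ s_bound (f := f).
- by rewrite s_S; have [_ _ /(_ x)] := rP n; lra.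
- apply: filterS (half_pow_small e_gt0) => n hn.
  by have [_ _ [q _ /(_ x)]] := GP n; rewrite -/(h n) in hn *; lra.
have s_rho n x : s n x <= rho x.
  by have := tail n x; have := normc_ge0 (f x - G n x); lra.
have rho_tail n x : rho x <= s n x + 4 * h n.
  apply: rho_le => m; have [nm|mn] := leqP n m.
    by rewrite -(subnKC nm); have := s_le n (m - n)%N x;
       have := h_gt0 (n + (m - n))%N; lra.
  by have := s_homo m (n - m)%N x; rewrite subnKC 1?ltnW //; have := h_gt0 n; lra.
have rho_ge0 x : 0 <= rho x.
  by have := s_rho 0%N x; rewrite /s big_nil addr0; have := r0_le x;
     have := normc_ge0 (G 0%N x); lra.
exists rho; split=> //.
  exists (b + 4) => x; rewrite rho_le ?andbT //.
  have := tail 0%N x; rewrite /s big_nil addr0.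
  have := normc_triangle (f x - G 0%N x) (G 0%N x); rewrite subrK.
  by have := r0_le x; lra.
apply/SDKP => e e_gt0; have e4_gt0 : 0 < e / 4 by lra.
have [n _ nP] := half_pow_small e4_gt0.
have hn : h n <= e / 4 by apply: nP => /=.
exists (fun x => (s n x)%:C); split.
- have s_fin : finite_set (range (s n)).
    elim: n {nP hn} => [|n IHn].
      by rewrite (_ : s 0%N = r0) //; apply/funext => x; rewrite /s big_nil addr0.
    have [r_fin _ _] := rP n; rewrite (_ : s n.+1 = fun x => s n x + r n x).
      exact: finite_image11.
    by apply/funext => x; rewrite s_S.
  exact: (finite_image11 (fun a _ => a%:C) s_fin s_fin).
- exists (b + 4), (s n); first exact/lsc_controls/controls_lsc/(cs n).
  move=> x; rewrite s_bound andbT normc_real ger0_norm //.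
  by have := s_homo 0%N n x; rewrite add0n {1}/s big_nil addr0;
     have := r0_le x; have := normc_ge0 (G 0%N x); lra.
rewrite (_ : (fun _ => _) = fun x => (rho x - s n x)%:C); last first.
  by apply/funext => x; rewrite rmorphB.
exists (fun x => rho x - s n x); last first.
  move=> x; have := s_rho n x; have := rho_tail n x.
  by rewrite normc_real; case: ger0P; lra.
(* A difference of lower semi-continuous functions need not be one; here [rho - s n] is a supremum
   of finite sums of the [r k] with [k >= n]. *)
apply: lsc_controls; apply: (@lsc_sup (fun m x => \sum_(n <= k < n + m) r k x)).
- by move=> m; apply: lsc_sum => k; have [_ cr _] := rP k; exact: controls_lsc cr.
- by move=> m x; have := s_rho (n + m)%N x; rewrite s_D; lra.
move=> x d d_gt0; have [m xm] := appr x _ d_gt0; exists m.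
by have := s_homo m n x; rewrite addnC s_D; lra.
Qed.

End StrongD.

(** * The decomposition and the modulus *)

Theorem theorem5 (R : realType) (K : metricType R) (f : K -> R[i])
    (hf : SDK f) :
  (exists phi1 phi2 phi3 phi4 : K -> R,
     [/\ bounded_lsc phi1 /\ SDK (fun k => (phi1 k)%:C),
         bounded_lsc phi2 /\ SDK (fun k => (phi2 k)%:C),
         bounded_lsc phi3 /\ SDK (fun k => (phi3 k)%:C),
         bounded_lsc phi4 /\ SDK (fun k => (phi4 k)%:C)
       & f = complex_diff phi1 phi2 phi3 phi4])
  /\ SDK (fun k => `|f k|).
Proof.
(* The norm of [R[i]] unfolds to the modulus embedded as a real complex number. *)
split; last exact: SDK_normc.
have [rho [cf [e f_le] rhoS]] := SDK_controls hf.
have rho_lsc := control_bounded_lsc cf f_le.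
have add_part (l : R[i] -> R) : (forall z w, l (z - w) = l z - l w) ->
    (forall z, `|l z| <= normc z) -> bounded_lsc (fun x => rho x + l (f x)) /\
    SDK (fun x => (rho x + l (f x))%:C).
  move=> lB l1; split.
    by apply: (controls_bounded_lsc _ l1 cf f_le) => z w; rewrite -lB.
  have lS : SDK (fun x => (l (f x))%:C).
    apply: (SDK_comp (l := fun z => (l z)%:C) _ _ hf) => [z w|z].
      by rewrite lB rmorphB.
    by rewrite normc_real.
  rewrite (_ : (fun _ => _) = fun x => (rho x)%:C + (l (f x))%:C).
    exact: SDK_add rhoS lS.
  by apply/funext => x; rewrite rmorphD.
exists (fun x => rho x + Re (f x)), rho, (fun x => rho x + Im (f x)), rho; split.
- by apply: (add_part (@Re R) _ (@normc_Re R)); case=> a b [c d].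
- exact: conj rho_lsc rhoS.
- by apply: (add_part (@Im R) _ (@normc_Im R)); case=> a b [c d].
- exact: conj rho_lsc rhoS.
apply/funext => x; rewrite /complex_diff !(addrC (rho x)) !addrK.
by case: (f x).
Qed.
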